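(* Let $\omega$ be the vacuum state on the monotone $C^*$-algebra $\mathfrak{M}$, let $\xi_\omega^\perp$ be the tail algebra of the corresponding process and let $\pi_\omega(\mathfrak{M})''_{\mathbb{Z}}$ be the stationary algebra of $\omega$. Then $\xi_\omega^\perp=\mathbb{C}P_\zeta+\mathbb{C}P_\zeta^\perp$ is strictly included in $\pi_\omega(\mathfrak{M})''_{\mathbb{Z}}$. Moreover, $\pi_\omega(\mathfrak{M})''_{\mathbb{Z}}$ is not commutative.
   Context: Monotone $C^*$-algebra. For $k\ge 1$ let $I_k=\{(i_1,\dots,i_k)\in\mathbb{Z}^k: i_1<\dots<i_k\}$. The discrete monotone Fock space is $\mathcal{F}_m=\bigoplus_{k\ge 0}\mathcal{H}_k$ with $\mathcal{H}_k=\ell^2(I_k)$ for $k\geq 1$ and $\mathcal{H}_0=\mathbb{C}\zeta$, $\zeta$ a unit vector (the vacuum); its canonical orthonormal basis is $\{\zeta\}\cup\{e_{(i_1,\dots,i_k)}\}$. For $i\in\mathbb{Z}$ the creation operator $a_i^\dagger$ is the bounded operator with $a_i^\dagger\zeta=e_{(i)}$ and $a_i^\dagger e_{(i_1,\dots,i_k)}=e_{(i,i_1,\dots,i_k)}$ if $i<i_1$, and $0$ otherwise. The annihilation operator $a_i$ is its adjoint. $\mathfrak{M}\subset\mathcal{B}(\mathcal{F}_m)$ is the unital $C^*$-algebra generated by $\{a_i:i\in\mathbb{Z}\}$. The vacuum state is $\omega(Y)=\langle Y\zeta,\zeta\rangle$; its GNS representation $\pi_\omega$ is (identified with) the identity representation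 on $\mathcal{F}_m$. $P_\zeta$ is the orthogonal projection onto $\mathbb{C}\zeta$ and $P_\zeta^\perp=I-P_\zeta$. Tail algebra. For $j\in\mathbb{Z}$ define $\iota_j:\mathbb{M}_2(\mathbb{C})\oplus\mathbb{C}\to\mathcal{B}(\mathcal{F}_m)$ by $\iota_j((\alpha_{r,s})\oplus\beta)=\alpha_{1,1}a_ja_j^\dagger+\alpha_{1,2}a_j+\alpha_{2,1}a_j^\dagger+\alpha_{2,2}a_j^\dagger a_j+\beta(I-a_ja_j^\dagger-a_j^\dagger a_j)$. With $\bigvee$ denoting the von Neumann algebra generated, $$\xi_\omega^\perp:=\bigcap_{I\subset\mathbb{Z},\ I\text{ finite}}\Big(\bigcup_{K\cap I=\emptyset,\ K\text{ finite}}\Big(\bigvee_{k\in K}\iota_k(\mathbb{M}_2(\mathbb{C})\oplus\mathbb{C})\Big)\Big)''.$$ Stationary algebra. Let $U$ be the unitary on $\mathcal{F}_m$ with $U\zeta=\zeta$, $Ue_{(i_1,\dots,i_n)}=e_{(i_1+1,\dots,i_n+1)}$, which implements the shift automorphism $\alpha_\tau(a_i)=a_{i+1}$ of $\mathfrak{M}$. Then $\pi_\omega(\mathfrak{M})''_{\mathbb{Z}}:=\{T\in\mathcal{B}(\mathcal{F}_m):UTU^*=T\}$. *)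

(* Defs.v *)
From HB Require Import structures.
From mathcomp Require Import all_boot all_order all_algebra.
From mathcomp Require Import all_classical all_reals all_analysis.
From mathcomp Require Import complex.
From mathcomp Require Import ring.

Set Implicit Arguments.
Unset Strict Implicit.
Unset Printing Implicit Defensive.

Import Order.TTheory GRing.Theory Num.Theory.

Local Open Scope classical_set_scope.
Local Open Scope ring_scope.
Local Open Scope complex_scope.

Definition sqsummable (R : realType) (I : choiceType) : {pred I -> R[i]} :=
  [pred x | (\esum_(s in [set: I]) (Normc.normc (x s) ^+ 2)%:E < +oo)%E].

Lemma sqsummable_submod (R : realType) (I : choiceType) :
  submod_closed (@sqsummable R I).
Proof.
split=> [|a x y].
  rewrite inE esum1 ?ltry// => s _.
  by rewrite -[(0 : I -> R[i]) s]/(0 : R[i]) Normc.normc0 expr0n.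
rewrite !inE => xS yS.
pose b := 2 * Normc.normc a ^+ 2.
have b0 : 0 <= b by rewrite mulr_ge0 ?sqr_ge0.
have n0 (z : R[i]) : 0 <= Normc.normc z by case: z => u v; exact: sqrtr_ge0.
have ge0 (z : R[i]) : (0%E <= (Normc.normc z ^+ 2)%:E)%E.
  by rewrite lee_fin sqr_ge0.
have sumZ (c : R) (z : I -> R[i]) : 0 <= c ->
    (\esum_(s in [set: I]) (Normc.normc (z s) ^+ 2)%:E < +oo ->
     \esum_(s in [set: I]) (c * Normc.normc (z s) ^+ 2)%:E < +oo)%E.
  move=> c0 zS; apply: (@le_lt_trans _ _
    (c%:E * \esum_(s in [set: I]) (Normc.normc (z s) ^+ 2)%:E)%E).
    apply: ub_ereal_sup => _ [A [finA _] <-].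
    under eq_fsbigr do rewrite EFinM.
    rewrite -ge0_mule_fsumr//.
    rewrite lee_wpmul2l ?lee_fin//; apply: esum_ge.
    by exists A => //; split.
  by rewrite lte_mul_pinfty.
apply: (@le_lt_trans _ _ (\esum_(s in [set: I])
    ((b * Normc.normc (x s) ^+ 2)%:E + (2 * Normc.normc (y s) ^+ 2)%:E))%E).
  apply: le_esum => s _; rewrite -EFinD lee_fin.
  have := le_normcD (a * x s) (y s).
  rewrite Normc.normcM /b => h.
  have h2 : Normc.normc (a * x s + y s) ^+ 2 <=
      (Normc.normc a * Normc.normc (x s) + Normc.normc (y s)) ^+ 2.
    by rewrite lerXn2r// nnegrE ?addr_ge0 ?mulr_ge0.
  apply: (le_trans h2).
  rewrite -subr_ge0 [X in 0 <= X](_ : _ =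
    (Normc.normc a * Normc.normc (x s) - Normc.normc (y s)) ^+ 2) ?sqr_ge0//.
  by rewrite sqrrD sqrrB !exprMn; ring.
rewrite esumD//; first by rewrite lte_add_pinfty// sumZ.
  by move=> s _; rewrite lee_fin mulr_ge0 ?sqr_ge0.
by move=> s _; rewrite lee_fin mulr_ge0 ?sqr_ge0.
Qed.

HB.instance Definition _ (R : realType) (I : choiceType) :=
  GRing.isSubmodClosed.Build R[i] (I -> R[i]) (@sqsummable R I)
    (@sqsummable_submod R I).

Record ell2 (R : realType) (I : choiceType) : Type := Ell2 {
  ell2_val :> I -> R[i];
  ell2_valP : ell2_val \in @sqsummable R I
}.

HB.instance Definition _ (R : realType) (I : choiceType) :=
  [isSub for @ell2_val R I].
HB.instance Definition _ (R : realType) (I : choiceType) :=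
  [Choice of ell2 R I by <:].
HB.instance Definition _ (R : realType) (I : choiceType) :=
  [SubChoice_isSubLmodule of ell2 R I by <:].

Lemma ell2_inj (R : realType) (I : choiceType) (x y : ell2 R I) :
  (forall s, x s = y s) -> x = y.
Proof. by move=> xy; apply/val_inj/funext. Qed.

Lemma sqsummable_delta (R : realType) (I : choiceType) (s : I) :
  (fun t => (t == s)%:R) \in @sqsummable R I.
Proof.
rewrite inE (@le_lt_trans _ _ (\esum_(t in [set s]) 1%:E)%E)//; last first.
  by rewrite esum_set1 ?ltry// lee_fin.
rewrite [leRHS]esum_mkcond; apply: le_esum => t _.
have [->|ts] := eqVneq t s; first by rewrite mem_set// Normc.normc1 expr1n.
by rewrite Normc.normc0 expr0n /=; case: ifP.
Qed.

Definition delta (R : realType) (I : choiceType) (s : I) : ell2 R I :=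
  Ell2 (@sqsummable_delta R I s).

(* Relabelling along a partial injection of the index set; on basis vectors,
   delta t goes to delta s if g s = Some t, and to 0 if t is not a value of g. *)
Definition pullback (R : realType) (I : choiceType) (g : I -> option I)
    (x : I -> R[i]) : I -> R[i] :=
  fun s => if g s is Some t then x t else 0.

Lemma sqsummable_pullback (R : realType) (I : choiceType) (g : I -> option I)
    (x : I -> R[i]) :
  (forall s s' t, g s = Some t -> g s' = Some t -> s = s') ->
  x \in @sqsummable R I -> pullback g x \in @sqsummable R I.
Proof.
move=> g_inj; rewrite !inE; apply: le_lt_trans.
pose D := [set s | g s]; pose e s := odflt s (g s).
have -> : (\esum_(s in [set: I]) (Normc.normc (pullback g x s) ^+ 2)%:E =
           \esum_(s in D) (Normc.normc (x (e s)) ^+ 2)%:E)%E.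
  rewrite [RHS]esum_mkcond; apply: eq_esum => s _.
  rewrite /pullback /e; case gs : (g s) => [t|].
    by rewrite mem_set// /D /= gs.
  by rewrite memNset ?Normc.normc0 ?expr0n// /D /= gs.
rewrite -(esum_image D e (fun t => (Normc.normc (x t) ^+ 2)%:E))%E; last first.
  move=> s s'; rewrite !inE /D /e /=.
  case gs : (g s) => [t|] // _; case gs' : (g s') => [t'|] // _ /= tt'.
  by apply: (g_inj _ _ t); rewrite // gs' tt'.
rewrite esum_mkcond; apply: le_esum => s _.
by case: ifP => //; rewrite lee_fin sqr_ge0.
Qed.

(* The sum of a complex family, meaningful for absolutely summable ones:
   real and imaginary parts are summed separately, each as the difference of
   the sums of its positive and negative parts. *)
Definition rsum (R : realType) (I : choiceType) (f : I -> R) : R :=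
  fine (\esum_(s in [set: I]) (EFin \o f)^\+ s
        - \esum_(s in [set: I]) (EFin \o f)^\- s)%E.

Definition csum (R : realType) (I : choiceType) (f : I -> R[i]) : R[i] :=
  rsum (fun s => complex.Re (f s)) +i* rsum (fun s => complex.Im (f s)).

(* Linear in the first argument, antilinear in the second. *)
Definition inner (R : realType) (I : choiceType) (x y : ell2 R I) : R[i] :=
  csum (fun s => x s * conjc (y s)).

Definition ell2_norm (R : realType) (I : choiceType) (x : ell2 R I) : R :=
  Num.sqrt (fine (\esum_(s in [set: I]) (Normc.normc (x s) ^+ 2)%:E)).

Definition bounded_ops (R : realType) (I : choiceType) :
    set (ell2 R I -> ell2 R I) :=
  [set T | linear T /\ exists M : R,
    forall x : ell2 R I, ell2_norm (T x) <= M * ell2_norm x].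

Definition is_adjoint (R : realType) (I : choiceType)
    (T S : ell2 R I -> ell2 R I) : Prop :=
  bounded_ops S /\ forall x y, inner (T x) y = inner x (S y).

(* The adjoint of a bounded operator (it exists and is unique by Riesz). *)
Definition adjoint (R : realType) (I : choiceType)
    (T : ell2 R I -> ell2 R I) : ell2 R I -> ell2 R I :=
  xget (fun=> 0) [set S | is_adjoint T S].

Definition commutant (R : realType) (I : choiceType)
    (A : set (ell2 R I -> ell2 R I)) : set (ell2 R I -> ell2 R I) :=
  [set T | bounded_ops T /\ forall S, A S -> T \o S = S \o T].

Definition bicommutant (R : realType) (I : choiceType)
    (A : set (ell2 R I -> ell2 R I)) : set (ell2 R I -> ell2 R I) :=
  commutant (commutant A).

Definition von_neumann (R : realType) (I : choiceType)
    (A : set (ell2 R I -> ell2 R I)) : Prop :=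
  [/\ A `<=` @bounded_ops R I, (forall T, A T -> A (adjoint T))
    & bicommutant A = A].

Definition vN_generated (R : realType) (I : choiceType)
    (A : set (ell2 R I -> ell2 R I)) : set (ell2 R I -> ell2 R I) :=
  \bigcap_(B in [set B | von_neumann B /\ A `<=` B]) B.

(* The disjoint union of the I_k over k >= 0, where the empty sequence, the
   only element of I_0, labels the vacuum; the direct sum of the l^2(I_k) is
   then l^2 of this union. *)
Definition mseq : Type := {s : seq int | sorted <%R s}.
HB.instance Definition _ := Choice.on mseq.

Definition mseq0 : mseq := exist _ [::] isT.

Notation fock R := (ell2 R mseq).

Definition vacuum (R : realType) : fock R := delta R mseq0.

(* Removes the first entry of a sequence provided that it equals i. *)
Definition mseq_behead (i : int) (s : mseq) : option mseq :=
  if val s is j :: t then if j == i then insub t else None else None.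

Lemma mseq_behead_inj i s s' t :
  mseq_behead i s = Some t -> mseq_behead i s' = Some t -> s = s'.
Proof.
case: s s' => [[|j s] js] [[|j' s'] js'] //; rewrite /mseq_behead /=.
case: eqP => // ji; case: eqP => // ji'; subst j j'.
case: insubP => // u _ us [ut]; case: insubP => // u' _ us' [u't].
by apply/val_inj => /=; rewrite -us -us' ut u't.
Qed.

Definition creation (R : realType) (i : int) (x : fock R) : fock R :=
  Ell2 (sqsummable_pullback (@mseq_behead_inj i) (ell2_valP x)).

Definition annihilation (R : realType) (i : int) : fock R -> fock R :=
  adjoint (@creation R i).

Lemma creation_delta (R : realType) (i : int) (s : mseq)
    (is_ : sorted <%R (i :: val s)) :
  creation i (delta R s) = delta R (exist _ (i :: val s) is_).
Proof.
apply/ell2_inj => -[[|j t] jt] //=; rewrite /pullback /mseq_behead /= -val_eqE//=.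
rewrite eqseq_cons; case: eqP => //= _.
have t_s : sorted <%R t by move/path_sorted: jt.
by rewrite insubT /= -val_eqE.
Qed.

Lemma creation_vacuum (R : realType) (i : int) :
  creation i (vacuum R) = delta R (exist _ [:: i] isT).
Proof. exact: creation_delta. Qed.

Lemma creation_delta0 (R : realType) (i : int) (s : mseq) :
  ~~ sorted <%R (i :: val s) -> creation i (delta R s) = 0.
Proof.
move=> is_; apply/ell2_inj => -[[|j t] jt] //=.
rewrite /pullback /mseq_behead /=; case: eqP => // ji; subst j.
case: insubP => // u _ ut /=; have [us|//] := eqVneq u s.
by move: is_; rewrite -us ut jt.
Qed.

Lemma mseq_shift_subproof (k : int) (s : mseq) :
  sorted <%R [seq i + k | i <- val s].
Proof.
by rewrite sorted_map; apply: sub_sorted (valP s) => i j /=; rewrite ltrD2r.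
Qed.

Definition mseq_shift (k : int) (s : mseq) : mseq :=
  exist _ [seq i + k | i <- val s] (mseq_shift_subproof k s).

Lemma mseq_shift_inj k s s' t :
  Some (mseq_shift k s) = Some t -> Some (mseq_shift k s') = Some t -> s = s'.
Proof.
move=> [<-] [] ss'; apply/esym/val_inj.
by apply: inj_map ss'; exact: addIr.
Qed.

(* The shift unitary: its coordinates are (U x)_s = x_(s - 1). *)
Definition shift_op (R : realType) (x : fock R) : fock R :=
  Ell2 (sqsummable_pullback (@mseq_shift_inj (- 1)) (ell2_valP x)).

Lemma shift_delta (R : realType) (s : mseq) :
  shift_op (delta R s) = delta R (mseq_shift 1 s).
Proof.
apply/ell2_inj => t; rewrite /= /pullback; congr (nat_of_bool _)%:R.
apply/eqP/eqP => [<-|->]; apply/val_inj => /=; rewrite -map_comp.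
  by rewrite -[LHS]map_id; apply: eq_map => i /=; rewrite addrNK.
by rewrite -[RHS]map_id; apply: eq_map => i /=; rewrite addrK.
Qed.

(* The orthogonal projection onto the line spanned by the unit vector zeta. *)
Definition vacuum_proj (R : realType) (x : fock R) : fock R :=
  inner x (vacuum R) *: vacuum R.

(* The map iota_j, with M_2(C) (+) C represented by pairs and the matrix
   indices 1, 2 of the formula becoming 0, 1. *)
Definition site_map (R : realType) (j : int) (m : 'M[R[i]]_2 * R[i]) :
    fock R -> fock R :=
  let a := @annihilation R j in
  let ad := @creation R j in
  m.1 0 0 *: (a \o ad) + m.1 0 1 *: a + m.1 1 0 *: ad + m.1 1 1 *: (ad \o a)
  + m.2 *: (idfun - (a \o ad) - (ad \o a)).

Definition tail_algebra (R : realType) : set (fock R -> fock R) :=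
  \bigcap_(I in [set I : set int | finite_set I])
    bicommutant (\bigcup_(K in [set K : set int | finite_set K /\ K `&` I = set0])
      vN_generated (\bigcup_(k in K) range (@site_map R k))).

Definition stationary_algebra (R : realType) : set (fock R -> fock R) :=
  [set T | bounded_ops T /\ @shift_op R \o T \o adjoint (@shift_op R) = T].

Arguments bounded_ops R I : clear implicits.
Arguments tail_algebra R : clear implicits.
Arguments stationary_algebra R : clear implicits.

(* Main.v *)
Require Import Defs.
From HB Require Import structures.
From mathcomp Require Import all_boot all_order all_algebra.
From mathcomp Require Import all_classical all_reals all_analysis.
From mathcomp Require Import complex.
From mathcomp Require Import ring lra zify.

Set Implicit Arguments.
Unset Strict Implicit.
Unset Printing Implicit Defensive.

Import Order.TTheory GRing.Theory Num.Theory.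

Local Open Scope classical_set_scope.
Local Open Scope ring_scope.

(** All the concrete operators of the theorem permute basis vectors or send
them to 0: they are the [relabel]lings along partial injections of the index
set, their adjoints are the relabellings along the transposed injections, and
identities between them reduce to identities between partial maps on strictly
increasing sequences.  The remaining analytic input is that a bounded operator
is determined by its values on the basis ([bounded_op_ext]).

The tail algebra contains the vacuum projection P.  For each site k the
operator a_k a_k^+ is diagonal and keeps exactly the e_s with s empty or
k < s_1.  On a fixed basis vector it therefore acts as P as soon as k is large,
so an operator that commutes with a_k a_k^+ for all k outside a finite set
commutes with P ([vacuum_proj_commute]).

Conversely, let T be in the tail algebra and let N be a natural number.  If v
and w are both empty, or if both begin at a site of [-N, N], then the partial
isometry e_(uv) |-> e_(uw), where u runs over the sequences without any site in
[-N, N], commutes with a_k and a_k^+ for |k| > N: whether k may be put in front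
of uv depends on u and on the position of k with respect to the first entry of
v, and for k outside the window all sites of the window are alike.  These
[grafts] form a self-adjoint family, so their commutant is a von Neumann
algebra that contains all iota_k with |k| > N ([site_map_grafts]), and T
commutes with them ([tail_grafts]).  With v = w = s and N large this makes e_s
an eigenvector of T ([tail_diagonal]), and with two nonempty v, w it shows that
the eigenvalues at e_v and e_w agree ([tail_eigenvalue]).  Hence T lies in
C P + C (1 - P).

An equivariant partial injection defines a stationary operator.  The projection
onto the one-particle space and the partial isometry e_(i,i+1) |-> e_(i) arise
in this way and do not commute; since C P + C (1 - P) is commutative, the
inclusion of the tail algebra in the stationary algebra is strict. *)

(** * Bounded operators on l^2 of a set *)

Section SquareNorm.
Context {R : realType} {I : choiceType}.
Implicit Types (x y : ell2 R I) (T S : ell2 R I -> ell2 R I) (a : R[i]).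

(** The square of the norm satisfies the termwise bound [sqnormD], from which
sums of bounded operators are bounded. *)
Definition sqnorm x : R :=
  fine (\esum_(s in [set: I]) (Normc.normc (x s) ^+ 2)%:E).

Let sq_ge0 (z : R[i]) : (0 <= (Normc.normc z ^+ 2)%:E)%E.
Proof. by rewrite lee_fin sqr_ge0. Qed.

Lemma sqnormE x :
  (sqnorm x)%:E = (\esum_(s in [set: I]) (Normc.normc (x s) ^+ 2)%:E)%E.
Proof.
rewrite /sqnorm fineK// ge0_fin_numE ?esum_ge0//.
by have := ell2_valP x; rewrite inE.
Qed.

Lemma sqnorm_ge0 x : 0 <= sqnorm x.
Proof. by rewrite -lee_fin sqnormE esum_ge0. Qed.

Lemma sqnorm_coord x s : Normc.normc (x s) ^+ 2 <= sqnorm x.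
Proof.
rewrite -lee_fin sqnormE; apply: esum_ge; exists [set s]; first by split.
by rewrite fsbig_set1.
Qed.

Lemma sqnormD x y : sqnorm (x + y) <= 2 * sqnorm x + 2 * sqnorm y.
Proof.
have -> : 2 * sqnorm x + 2 * sqnorm y =
    (sqnorm x + sqnorm x) + (sqnorm y + sqnorm y) by ring.
rewrite -lee_fin !EFinD !sqnormE -!esumD//; first last.
- by move=> i _; rewrite adde_ge0.
- by move=> i _; rewrite adde_ge0.
apply: le_esum => s _; rewrite -!EFinD lee_fin.
have := le_normcD (x s) (y s); rewrite -[(x + y) s]/(x s + y s).
set u := Normc.normc (x s); set v := Normc.normc (y s).
have w0 : 0 <= Normc.normc (x s + y s) by case: (x s + y s) => ? ?; exact: sqrtr_ge0.
move=> h; have : Normc.normc (x s + y s) ^+ 2 <= (u + v) ^+ 2.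
  by rewrite lerXn2r// nnegrE (le_trans w0).
by have := sqr_ge0 (u - v); rewrite sqrrB sqrrD; lra.
Qed.

Lemma sqnormZ a x : sqnorm (a *: x) <= Normc.normc a ^+ 2 * sqnorm x.
Proof.
rewrite -lee_fin sqnormE; apply: ge_ereal_sup => _ [A [finA _] <-].
rewrite EFinM sqnormE.
under eq_fsbigr => s _ do
  rewrite -[(a *: x) s]/(a * x s) Normc.normcM exprMn EFinM.
rewrite -ge0_mule_fsumr// lee_wpmul2l//.
by apply: esum_ge; exists A => //; split.
Qed.

Lemma bounded_opsP T : bounded_ops R I T <->
  linear T /\ exists2 c : R, 0 <= c & forall x, sqnorm (T x) <= c * sqnorm x.
Proof.
split=> -[lT].
  move=> [M TM]; split=> //; exists (M ^+ 2); first exact: sqr_ge0.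
  move=> x; have := TM x; rewrite /ell2_norm -!/(sqnorm _) => h.
  have := sqr_sqrtr (sqnorm_ge0 x); have := sqr_sqrtr (sqnorm_ge0 (T x)).
  move=> <- <-; rewrite -exprMn lerXn2r// nnegrE ?sqrtr_ge0//.
  by rewrite (le_trans _ h)// sqrtr_ge0.
move=> [c c0 Tc]; split=> //; exists (Num.sqrt c) => x.
by rewrite /ell2_norm -!/(sqnorm _) -sqrtrM// ler_wsqrtr.
Qed.

Lemma bounded_ops_id : bounded_ops R I idfun.
Proof. by apply/bounded_opsP; split=> //; exists 1 => // x; rewrite mul1r. Qed.

Lemma bounded_ops_comp T S :
  bounded_ops R I T -> bounded_ops R I S -> bounded_ops R I (T \o S).
Proof.
move=> /bounded_opsP[lT [c c0 Tc]] /bounded_opsP[lS [d d0 Sd]].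
apply/bounded_opsP; split=> [a x y|]; first by rewrite /= lS lT.
exists (c * d) => [|x]; first by rewrite mulr_ge0.
by apply: (le_trans (Tc _)); rewrite -(mulrA c) ler_wpM2l.
Qed.

Lemma bounded_opsD T S :
  bounded_ops R I T -> bounded_ops R I S -> bounded_ops R I (T + S).
Proof.
move=> /bounded_opsP[lT [c c0 Tc]] /bounded_opsP[lS [d d0 Sd]].
apply/bounded_opsP; split=> [a x y|].
  by rewrite !fctE lT lS scalerDr addrACA.
exists (2 * c + 2 * d) => [|x]; first by rewrite addr_ge0 ?mulr_ge0.
apply: (le_trans (sqnormD _ _)); rewrite (mulrDl (2 * c)) -!(mulrA (2 : R)).
by rewrite lerD// ler_wpM2l.
Qed.

Lemma bounded_opsZ a T : bounded_ops R I T -> bounded_ops R I (a *: T).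
Proof.
move=> /bounded_opsP[lT [c c0 Tc]].
apply/bounded_opsP; split=> [b x y|].
  by rewrite !fctE lT scalerDr !scalerA mulrC.
exists (Normc.normc a ^+ 2 * c) => [|x]; first by rewrite mulr_ge0 ?sqr_ge0.
apply: (le_trans (sqnormZ _ _)); rewrite -(mulrA (Normc.normc a ^+ 2)).
by rewrite ler_wpM2l ?sqr_ge0.
Qed.

Lemma bounded_opsB T S :
  bounded_ops R I T -> bounded_ops R I S -> bounded_ops R I (T - S).
Proof.
by move=> bT bS; rewrite -scaleN1r; apply/bounded_opsD/bounded_opsZ.
Qed.

Lemma bounded_op0 T : bounded_ops R I T -> T 0 = 0.
Proof.
move=> [lT _]; apply: (@addrI _ (1 *: T 0)).
by rewrite -lT scaler0 add0r scale1r addr0.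
Qed.

Lemma bounded_op_scale T a x : bounded_ops R I T -> T (a *: x) = a *: T x.
Proof.
move=> bT; have [lT _] := bT.
by rewrite -[a *: x]addr0 lT (bounded_op0 bT) addr0.
Qed.

Lemma bounded_op_add T x y : bounded_ops R I T -> T (x + y) = T x + T y.
Proof. by move=> [lT _]; have := lT 1 x y; rewrite !scale1r. Qed.

Lemma bounded_op_sub T x y : bounded_ops R I T -> T (x - y) = T x - T y.
Proof.
by move=> bT; rewrite bounded_op_add// -scaleN1r bounded_op_scale// scaleN1r.
Qed.

Lemma bounded_op_sum T (J : Type) (r : seq J) (f : J -> ell2 R I) :
  bounded_ops R I T -> T (\sum_(j <- r) f j) = \sum_(j <- r) T (f j).
Proof.
move=> bT; apply: big_morph => [x y|]; first exact: bounded_op_add.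
exact: bounded_op0.
Qed.

Lemma sum_deltaE x (r : seq I) t : uniq r ->
  (\sum_(s <- r) x s *: delta R s) t = if t \in r then x t else 0.
Proof.
move=> ur; transitivity (\sum_(s <- r) x s * (t == s)%:R).
  exact: (big_morph (fun y : ell2 R I => y t)).
elim: r ur => [|s r IH] /=; first by rewrite big_nil.
move=> /andP[sr /IH]; rewrite big_cons inE => ->.
case: eqP => [->|] /=; first by rewrite (negPf sr) mulr1 addr0.
by rewrite mulr0 add0r.
Qed.

(** Beyond a finite set of coordinates that nearly exhausts the total sum of
squares, only a small remainder is left. *)
Lemma finite_approx x (e : R) : 0 < e ->
  exists2 r : seq I, uniq r &
    sqnorm (x - \sum_(s <- r) x s *: delta R s) < e.
Proof.
move=> e0; have fx : (\esum_(s in [set: I]) (Normc.normc (x s) ^+ 2)%:E)%E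
    \is a fin_num by rewrite -sqnormE.
have [_ [A [finA _] <-]] := ub_ereal_sup_adherent e0 fx.
rewrite -/(esum _ _) -sqnormE => hA; exists (finmap.enum_fset (fset_set A)).
  exact: finmap.fset_uniq.
set y := x - _; have yE s : y s = if s \in A then 0 else x s.
  rewrite -[y s]/(x s - (\sum_(s <- _) x s *: delta R s) s) sum_deltaE//.
  by rewrite in_fset_set//; case: ifP; rewrite ?subrr ?subr0.
have := sqnormE x; rewrite (esumID A)// !setTI esum_fset// => h.
have yy : (\esum_(s in ~` A) (Normc.normc (x s) ^+ 2)%:E = (sqnorm y)%:E)%E.
  rewrite sqnormE esum_mkcond; apply: eq_esum => s _; rewrite yE in_setC.
  by case: (s \in A); rewrite // Normc.normc0 expr0n.
move: h hA; rewrite yy; case: (\sum_(i \in A) _)%E => [r|//|//].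
by rewrite -EFinD -EFinB lte_fin => -[->]; lra.
Qed.

(** The finite combinations of basis vectors are dense ([finite_approx]), and
a coordinate of a vector is bounded by its norm. *)
Lemma bounded_op_ext T S : bounded_ops R I T -> bounded_ops R I S ->
  (forall s, T (delta R s) = S (delta R s)) -> T = S.
Proof.
move=> bT bS TS; apply/funext => x; apply/eqP; rewrite -subr_eq0; apply/eqP.
have /bounded_opsP[_ [c c0 Dc]] := bounded_opsB bT bS.
apply/ell2_inj => t; rewrite -[RHS]/(0 : R[i]); apply: Normc.eq0_normc.
apply/eqP; rewrite -sqrf_eq0 eq_le sqr_ge0 andbT; apply/ler_addgt0Pl => e e0.
have d0 : 0 < e / (c + 1) by rewrite divr_gt0// ltr_wpDl.
have [r _ xr] := finite_approx x d0; rewrite addr0.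
set z := \sum_(s <- r) _ in xr.
have -> : T x - S x = (T - S) (x - z).
  rewrite bounded_op_sub; last exact: bounded_opsB.
  rewrite bounded_op_sum; last exact: bounded_opsB.
  rewrite big1 ?subr0// => s _; rewrite bounded_op_scale; last exact: bounded_opsB.
  by rewrite fctE TS subrr scaler0.
apply: (le_trans (sqnorm_coord _ _)); apply: (le_trans (Dc _)).
apply: (@le_trans _ _ (c * (e / (c + 1)))); first by rewrite ler_wpM2l// ltW.
rewrite mulrCA ler_piMr ?(ltW e0)// ler_pdivrMr ?ltr_wpDl// mul1r; lra.
Qed.

End SquareNorm.

(** * Relabellings of the basis and their adjoints *)

Section Relabelling.
Context {R : realType} {I : choiceType}.
Implicit Types (x y : ell2 R I) (g h : I -> option I).

(** The graph of [h] is that of [g] with its two coordinates exchanged; thus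
[g] and [h] are mutually inverse partial injections. *)
Definition transposed g h := forall s t, g s = Some t <-> h t = Some s.

Lemma transposed_sym g h : transposed g h -> transposed h g.
Proof. by move=> gh s t; split=> /gh. Qed.

Lemma transposed_inj g h : transposed g h ->
  forall s s' t, g s = Some t -> g s' = Some t -> s = s'.
Proof. by move=> gh s s' t /gh + /gh => -> [->]. Qed.

(** This partial isometry sends the basis vector of [t] to that of [s] if
[g s = Some t], and to 0 if [t] is not a value of [g]. *)
Definition relabel g h (gh : transposed g h) x : ell2 R I :=
  Ell2 (sqsummable_pullback (transposed_inj gh) (ell2_valP x)).

(** Both sides sum [f] over the common graph of [g] and the transpose of [h]. *)
Lemma esum_transposed g h (f : I -> I -> \bar R) : transposed g h ->
  (\esum_(s in [set: I]) (if g s is Some t then f s t else 0) =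
   \esum_(t in [set: I]) (if h t is Some s then f s t else 0))%E.
Proof.
move=> gh; pose D := [set s | g s]; pose D' := [set t | h t].
pose e s := odflt s (g s).
pose F t := (if h t is Some s then f s t else 0)%E.
transitivity (\esum_(s in D) F (e s))%E.
  rewrite [RHS]esum_mkcond; apply: eq_esum => s _; rewrite /F /e.
  case gs: (g s) => [t|] /=; last by rewrite memNset// /D /= gs.
  by rewrite mem_set /D /= ?gs//; move/gh: gs => ->.
rewrite -(@reindex_esum R _ _ D D' e F); first last.
  split=> [s|s s'|t]; rewrite ?inE /D /D' /e /=.
  - by case gs: (g s) => [t|] // _; move/gh: gs => ->.
  - case gs: (g s) => [t|] // _; case gs': (g s') => [t'|] // _ /= tt'.
    by apply: (transposed_inj gh gs); rewrite tt'.
  - by case ht: (h t) => [s|] // _; move/gh: ht => gs; exists s; rewrite /= gs.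
rewrite [LHS]esum_mkcond; apply: eq_esum => t _; rewrite /F.
case ht: (h t) => [s|]; first by rewrite mem_set// /D' /= ht.
by case: ifP.
Qed.

(** The positive and negative parts of the real and imaginary parts are
reindexed one by one. *)
Lemma csum_transposed g h (f : I -> I -> R[i]) : transposed g h ->
  csum (fun s => if g s is Some t then f s t else 0) =
  csum (fun t => if h t is Some s then f s t else 0).
Proof.
move=> gh; have rs (f' : I -> I -> R) :
    rsum (fun s => if g s is Some t then f' s t else 0) =
    rsum (fun t => if h t is Some s then f' s t else 0).
  congr (fine (_ - _)%E).
    have := esum_transposed (fun s t => Order.max (f' s t)%:E 0%E) gh.
    congr (_ = _); apply: eq_esum => s _; rewrite funeposE /=;
    by [case: (g s) => //; rewrite maxxx | case: (h s) => //; rewrite maxxx].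
  have := esum_transposed (fun s t => Order.max (- (f' s t)%:E)%E 0%E) gh.
  congr (_ = _); apply: eq_esum => s _; rewrite funenegE /=;
  by [case: (g s) => [t //|]; rewrite ?oppr0 ?oppe0 maxxx
     | case: (h s) => [t //|]; rewrite ?oppr0 ?oppe0 maxxx].
have part (k : R[i] -> R) : k 0 = 0 ->
    rsum (fun s => k (if g s is Some t then f s t else 0)) =
    rsum (fun t => k (if h t is Some s then f s t else 0)).
  move=> k0; transitivity (rsum (fun s => if g s is Some t then k (f s t) else 0)).
    by congr rsum; apply/funext => s; case: (g s).
  by rewrite rs; congr rsum; apply/funext => t; case: (h t).
by rewrite /csum !part.
Qed.

Lemma csum_single (f : I -> R[i]) t : (forall s, s != t -> f s = 0) ->
  csum f = f t.
Proof.
have esum1t (a : I -> \bar R) : (0 <= a t)%E ->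
    (forall s, s != t -> a s = 0%E) -> (\esum_(s in [set: I]) a s = a t)%E.
  move=> at0 a0; rewrite -(esum_set1 at0) [RHS]esum_mkcond.
  apply: eq_esum => s _; case: (eqVneq s t) => [->|st].
    by rewrite mem_set.
  by rewrite memNset ?a0//= => /eqP; rewrite (negPf st).
have rs (f' : I -> R) : (forall s, s != t -> f' s = 0) -> rsum f' = f' t.
  move=> f0; rewrite /rsum !esum1t ?funepos_ge0 ?funeneg_ge0//.
  - by have /(congr1 (@^~ t)) /= <- := funeposneg (EFin \o f').
  - by move=> s /f0 f0s; rewrite funenegE /= f0s ?oppr0 ?oppe0 maxxx.
  - by move=> s /f0 f0s; rewrite funeposE /= f0s maxxx.
move=> f0; rewrite /csum !rs; first by case: (f t).
  by move=> s /f0 ->.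
by move=> s /f0 ->.
Qed.

Lemma inner_delta_r x t : inner x (delta R t) = x t.
Proof.
rewrite /inner (@csum_single _ t) /= ?eqxx ?conjc1 ?mulr1// => s /negPf ->.
by rewrite conjc0 mulr0.
Qed.

Lemma inner_delta_l y t : inner (delta R t) y = conjc (y t).
Proof.
rewrite /inner (@csum_single _ t) /= ?eqxx ?mul1r// => s /negPf ->.
by rewrite mul0r.
Qed.

Lemma inner_relabel g h (gh : transposed g h) x y :
  inner (relabel gh x) y = inner x (relabel (transposed_sym gh) y).
Proof.
transitivity (csum (fun s => if g s is Some t then x t * conjc (y s) else 0)).
  congr csum; apply/funext => s; rewrite /= /pullback.
  by case: (g s) => // ; rewrite mul0r.
rewrite (csum_transposed _ gh); congr csum; apply/funext => t.
by rewrite /= /pullback; case: (h t) => //; rewrite conjc0 mulr0.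
Qed.

Lemma sqnorm_relabel g h (gh : transposed g h) x :
  sqnorm (relabel gh x) <= sqnorm x.
Proof.
rewrite -lee_fin !sqnormE.
have := esum_transposed (fun s t => (Normc.normc (x t) ^+ 2)%:E) gh.
rewrite [X in X = _ -> _](_ : _ =
  \esum_(s in [set: I]) (Normc.normc (relabel gh x s) ^+ 2)%:E)%E; last first.
  apply: eq_esum => s _; rewrite /= /pullback.
  by case: (g s) => //; rewrite Normc.normc0 expr0n.
move=> ->; apply: le_esum => t _; case: (h t) => //.
by rewrite lee_fin sqr_ge0.
Qed.

Lemma bounded_relabel g h (gh : transposed g h) : bounded_ops R I (relabel gh).
Proof.
apply/bounded_opsP; split=> [a x y|].
  apply/ell2_inj => s.
  rewrite -[RHS]/(a * pullback g x s + pullback g y s) /= /pullback.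
  by case: (g s) => [t //|]; rewrite mulr0 addr0.
by exists 1 => // x; rewrite mul1r sqnorm_relabel.
Qed.

Lemma relabel_adjoint g h (gh : transposed g h) :
  is_adjoint (relabel gh) (relabel (transposed_sym gh)).
Proof. by split; [exact: bounded_relabel|exact: inner_relabel]. Qed.

Lemma adjointE (T S : ell2 R I -> ell2 R I) : is_adjoint T S -> adjoint T = S.
Proof.
move=> TS; have [_ aT] : is_adjoint T (adjoint T) by apply: xgetPex; exists S.
apply/funext => y; apply/ell2_inj => t; apply: (can_inj (@conjcK R)).
by rewrite -!inner_delta_l -aT; case: TS => _ ->.
Qed.

(** Taking adjoints turns the commutation of T with W into that of S with V.
On basis vectors only the two defining identities of the adjoint are used. *)
Lemma adjoint_commute (T S V W : ell2 R I -> ell2 R I) :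
  is_adjoint T S -> is_adjoint W V ->
  T \o W = W \o T -> S \o V = V \o S.
Proof.
move=> [_ TS] [_ WV] TW; apply/funext => y; apply/ell2_inj => t.
apply: (can_inj (@conjcK R)); rewrite -!inner_delta_l /=.
rewrite -TS -[LHS]WV -[RHS]WV -TS.
by have /(congr1 (fun F => F (delta R t))) /= -> := TW.
Qed.

End Relabelling.

(** * Commutants *)

Section Commutants.
Context {R : realType} {I : choiceType}.
Implicit Types (T S : ell2 R I -> ell2 R I) (X : set (ell2 R I -> ell2 R I)).

(** The bicommutant identity is the equality of the commutant with the third
commutant.  For the stability under [adjoint]: if T has an adjoint, then
[adjoint_commute] applies to it; otherwise [adjoint T] is by definition 0, which
lies in every commutant. *)
Lemma von_neumann_commutant X : X `<=` bounded_ops R I ->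
  (forall V, X V -> exists2 W, X W & is_adjoint W V) ->
  von_neumann (commutant X).
Proof.
move=> Xb Xadj; split; first by move=> T [].
  move=> T [bT TX].
  have [[S TS]|noS] := pselect (exists S, is_adjoint T S).
    rewrite (adjointE TS); split=> [|V XV]; first by case: TS.
    by have [W XW WV] := Xadj V XV; apply: (adjoint_commute TS WV); exact: TX.
  rewrite /adjoint xgetPN; last by move=> S TS; apply: noS; exists S.
  have -> : (fun=> 0) = (0 : R[i]) *: (idfun : ell2 R I -> ell2 R I).
    by apply/funext => x; rewrite fctE scale0r.
  split=> [|V XV]; first exact/bounded_opsZ/bounded_ops_id.
  by apply/funext => x; rewrite /= !fctE bounded_op_scale//; exact: Xb.
apply/seteqP; split=> T [bT TX]; split=> // S XS.
  apply: TX; split; first exact: Xb.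
  by move=> V [_ VX]; rewrite VX.
by case: XS => _ ->.
Qed.

Section Closure.
Context {X : set (ell2 R I -> ell2 R I)} (Xb : X `<=` bounded_ops R I).

Lemma commutant_id : commutant X idfun.
Proof. by split; first exact: bounded_ops_id. Qed.

Lemma commutant_comp T S :
  commutant X T -> commutant X S -> commutant X (T \o S).
Proof.
move=> [bT TX] [bS SX]; split=> [|V XV]; first exact: bounded_ops_comp.
by rewrite -compA SX// compA TX.
Qed.

Lemma commutantD T S : commutant X T -> commutant X S -> commutant X (T + S).
Proof.
move=> [bT TX] [bS SX]; split=> [|V XV]; first exact: bounded_opsD.
have /= TV := congr1 (@^~ _) (TX V XV); have /= SV := congr1 (@^~ _) (SX V XV).
apply/funext => x; rewrite /= !fctE TV SV.
by rewrite (@bounded_op_add _ _ V)//; exact: Xb.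
Qed.

Lemma commutantZ a T : commutant X T -> commutant X (a *: T).
Proof.
move=> [bT TX]; split=> [|V XV]; first exact: bounded_opsZ.
have /= TV := congr1 (@^~ _) (TX V XV); apply/funext => x; rewrite /= !fctE TV.
by rewrite (@bounded_op_scale _ _ V)//; exact: Xb.
Qed.

Lemma commutantB T S : commutant X T -> commutant X S -> commutant X (T - S).
Proof. by move=> ? ?; rewrite -scaleN1r; apply/commutantD/commutantZ. Qed.

End Closure.

End Commutants.

(** * Relabellings on basis vectors *)

Section Restriction.
Context {R : realType} {I : choiceType}.

(** Relabelling along this partial identity is the projection onto the span of
the basis vectors whose index satisfies [p]. *)
Definition id_on (p : pred I) (s : I) := if p s then Some s else None.

Lemma id_on_transposed p : transposed (id_on p) (id_on p).
Proof.
by move=> s t; rewrite /id_on; split; case: ifP => // ps [<-]; rewrite ps.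
Qed.

Lemma relabel_delta g h (gh : transposed g h) (s t : I) : g t = Some s ->
  relabel gh (delta R s) = delta R t.
Proof.
move=> gt; apply/ell2_inj => u; rewrite /= /pullback.
case gu: (g u) => [s'|].
  congr (nat_of_bool _)%:R; apply/eqP/eqP => [ss|ut].
    by apply: (transposed_inj gh gu); rewrite ss.
  by move: gu; rewrite ut gt => -[].
by case: eqP gu => // ->; rewrite gt.
Qed.

Lemma relabel_delta0 g h (gh : transposed g h) (s : I) : h s = None ->
  relabel gh (delta R s) = 0.
Proof.
move=> hs; apply/ell2_inj => u; rewrite /= /pullback.
by case gu: (g u) => [t|] //=; case: eqP gu => // -> /gh; rewrite hs.
Qed.

Lemma pullback_comp (f g : I -> option I) (x : I -> R[i]) :
  pullback f (pullback g x) = pullback (fun s => obind g (f s)) x.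
Proof. by apply/funext => s; rewrite /pullback; case: (f s). Qed.

End Restriction.

Lemma option_map_inj (A B : Type) (f : A -> B) :
  injective f -> injective (omap f).
Proof. by move=> fi [a|] [b|] //= [] /fi ->. Qed.

(** * Creators, annihilators and the vacuum projection *)

Section Fock.
Context {R : realType}.
Implicit Types (i k : int) (N : nat) (s t v w : mseq).

Definition mseq_cons i s : option mseq := insub (i :: val s).

Lemma behead_cons_transposed i : transposed (mseq_behead i) (mseq_cons i).
Proof.
move=> s t; rewrite /mseq_behead /mseq_cons; split.
  case: s => -[|j s] js //=; case: eqP => // ji; subst j.
  by case: insubP => //= u _ us [<-]; rewrite us (insubT (sorted <%R) js).
case: insubP => //= u _ ut [<-]; rewrite ut eqxx.
by rewrite valK.
Qed.

Lemma creationE i : @creation R i = relabel (behead_cons_transposed i).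
Proof. by apply/funext => x; exact: ell2_inj. Qed.

Lemma creation_adjoint i : is_adjoint (@creation R i) (@annihilation R i).
Proof.
have ad := @relabel_adjoint R _ _ _ (behead_cons_transposed i).
by rewrite /annihilation creationE (adjointE ad).
Qed.

Lemma annihilationE i :
  @annihilation R i = relabel (transposed_sym (behead_cons_transposed i)).
Proof. by rewrite /annihilation creationE; exact/adjointE/relabel_adjoint. Qed.

Lemma bounded_creation i : bounded_ops R mseq (@creation R i).
Proof. by rewrite creationE; exact: bounded_relabel. Qed.

Lemma bounded_annihilation i : bounded_ops R mseq (@annihilation R i).
Proof. by rewrite annihilationE; exact: bounded_relabel. Qed.

(** Creating k before annihilating it only tests whether k may be put in front
of the sequence. *)
Lemma annihilation_creation_coord i (x : fock R) s :
  annihilation i (creation i x) s = if sorted <%R (i :: val s) then x s else 0.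
Proof.
rewrite annihilationE creationE; case: ifP => is_.
  have [t cs] : exists t, mseq_cons i s = Some t.
    by rewrite /mseq_cons; case: insubP => [t|]; [exists t|rewrite is_].
  rewrite /= pullback_comp /pullback cs /=.
  by move: cs => /(behead_cons_transposed i t s) ->.
by rewrite /= /pullback /mseq_cons insubF.
Qed.

Lemma vacuum_projE :
  @vacuum_proj R = relabel (id_on_transposed (pred1 mseq0)).
Proof.
apply/funext => x; apply/ell2_inj => s.
rewrite /vacuum_proj inner_delta_r -[LHS]/(x mseq0 * (s == mseq0)%:R).
rewrite /= /pullback /id_on /=.
by case: eqP => [->|]; rewrite ?mulr1 ?mulr0.
Qed.

Lemma bounded_vacuum_proj : bounded_ops R mseq (@vacuum_proj R).
Proof. by rewrite vacuum_projE; exact: bounded_relabel. Qed.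

Lemma vacuum_proj_delta s :
  vacuum_proj (delta R s) = if s == mseq0 then delta R s else 0.
Proof.
rewrite vacuum_projE; case: ifP => s0.
  by apply: relabel_delta; rewrite /id_on /= s0.
by apply: relabel_delta0; rewrite /id_on /= s0.
Qed.

(** The general element of C P + C (1 - P). *)
Definition vacuum_diag (a b : R[i]) : fock R -> fock R :=
  a *: @vacuum_proj R + b *: (idfun - @vacuum_proj R).

Lemma commutant_vacuum_diag a b (T : fock R -> fock R) : bounded_ops R mseq T ->
  @vacuum_proj R \o T = T \o @vacuum_proj R ->
  commutant [set T] (vacuum_diag a b).
Proof.
move=> bT PT; have Tb : [set T] `<=` bounded_ops R mseq by move=> _ ->.
have PX : commutant [set T] (@vacuum_proj R).
  by split=> [|_ ->]//; exact: bounded_vacuum_proj.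
apply: (commutantD Tb); first exact: (commutantZ Tb).
by apply/(commutantZ Tb)/(commutantB Tb) => //; exact: commutant_id.
Qed.

Lemma vacuum_diag_commute a b (T : fock R -> fock R) : bounded_ops R mseq T ->
  @vacuum_proj R \o T = T \o @vacuum_proj R ->
  vacuum_diag a b \o T = T \o vacuum_diag a b.
Proof. by move=> bT PT; apply: (commutant_vacuum_diag _ _ bT PT).2. Qed.

Lemma bounded_vacuum_diag a b : bounded_ops R mseq (vacuum_diag a b).
Proof. exact: (commutant_vacuum_diag a b (@bounded_ops_id _ _) erefl).1. Qed.

Lemma exists_outside (A : set int) (i : int) : finite_set A ->
  exists2 k, i <= k & ~ A k.
Proof.
move=> /finite_fsetP[F ->].
pose m : int := \sum_(x <- finmap.enum_fset F) `|x|.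
exists (`|i| + m + 1).
  rewrite -addrA (le_trans (ler_norm i))// lerDl addr_ge0// sumr_ge0//.
move=> /= kF.
have : `|i| + m + 1 <= m.
  rewrite {2}/m (big_rem _ kF)/=.
  by rewrite (le_trans (ler_norm _))// lerDl sumr_ge0.
by rewrite addrAC gerDr; apply/negP; rewrite -ltNge ltr_wpDl.
Qed.

(** For a site k beyond the first entry of a nonempty s, a_k a_k^+ kills e_s,
whereas it fixes the vacuum.  A site outside the finite set [A] can be chosen
that far to the right; so T fixes the vacuum line and maps the other basis
vectors to vectors orthogonal to it. *)
Lemma vacuum_proj_commute (A : set int) (T : fock R -> fock R) :
  finite_set A -> bounded_ops R mseq T ->
  (forall k, ~ A k -> T \o (@annihilation R k \o @creation R k) =
                      (@annihilation R k \o @creation R k) \o T) ->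
  @vacuum_proj R \o T = T \o @vacuum_proj R.
Proof.
move=> finA bT TQ.
have bP := bounded_vacuum_proj.
apply: (bounded_op_ext (bounded_ops_comp bP bT) (bounded_ops_comp bT bP)).
have above (t : mseq) : t != mseq0 ->
    exists2 k, ~ A k & ~~ sorted <%R (k :: val t).
  rewrite -val_eqE; case: t => -[|j t] jt //= _.
  have [k jk Ak] := exists_outside j finA.
  by exists k => //=; rewrite ltNge jk.
have TQE k x : ~ A k ->
    T (annihilation k (creation k x)) = annihilation k (creation k (T x)).
  by move=> /TQ /(congr1 (@^~ x)).
move=> s; rewrite /= vacuum_proj_delta vacuum_projE; apply/ell2_inj => t.
rewrite /= /pullback /id_on /=; have [->{s}|s0] := eqVneq s mseq0.
  have [-> //|t0] := eqVneq t mseq0.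
  have [k Ak kt] := above t t0.
  have <- : annihilation k (creation k (delta R mseq0)) = delta R mseq0.
    apply/ell2_inj => u; rewrite annihilation_creation_coord /=.
    have [->//|_] := eqVneq u mseq0; by case: ifP.
  by rewrite TQE// annihilation_creation_coord (negPf kt).
rewrite (bounded_op0 bT).
have [->|//] := eqVneq t mseq0.
have [k Ak ks] := above s s0.
have := TQE k (delta R s) Ak.
have -> : annihilation k (creation k (delta R s)) = 0.
  apply/ell2_inj => u; rewrite annihilation_creation_coord.
  have [->|us] := eqVneq u s; first by rewrite (negPf ks).
  by rewrite /= (negPf us); case: ifP.
rewrite (bounded_op0 bT).
move=> /(congr1 (fun x : fock R => x mseq0)).
by rewrite annihilation_creation_coord /= => <-.
Qed.

End Fock.

(** * Replacing the tail of a sequence *)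

Section Graft.
Context (N : nat).
Implicit Types (i k : int) (s t v w : seq int) (r : mseq).

Definition in_window i := `|i| <= N%:Z.

(** Two sequences can replace each other after any u that avoids the window if
either both are empty, or both begin in the window. *)
Definition same_stem v w : bool :=
  match v, w with
  | [::], [::] => true
  | i :: _, j :: _ => in_window i && in_window j
  | _, _ => false
  end.

Lemma same_stem_sym v w : same_stem v w -> same_stem w v.
Proof. by case: v w => [|i v] [|j w] //=; rewrite andbC. Qed.

(** Maps u ++ w to u ++ v when no entry of u is in the window, and is undefined
on the other sequences. *)
Fixpoint graft v w s : option (seq int) :=
  if s == w then Some v else
  if s is k :: s' then
    if in_window k then None else omap (cons k) (graft v w s')
  else None.

Lemma graftE v w s : graft v w s =
  if s == w then Some v else
  if s is k :: s' then
    if in_window k then None else omap (cons k) (graft v w s')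
  else None.
Proof. by case: s. Qed.

Lemma graft_stem v w : graft v w w = Some v.
Proof. by rewrite graftE eqxx. Qed.

Lemma graft_cons v w k s : same_stem v w -> ~~ in_window k ->
  graft v w (k :: s) = omap (cons k) (graft v w s).
Proof.
move=> vw kN; rewrite [LHS]graftE; case: eqP vw => [<-|_];
  last by rewrite (negPf kN).
by case: v => [//|i v] /=; rewrite (negPf kN) andbF.
Qed.

Lemma graft_self_None v s : (all in_window s) -> s != v -> graft v v s = None.
Proof. by rewrite graftE => + /negPf ->; case: s => //= k s /andP[->]. Qed.

Lemma graft_sym v w s t : same_stem v w ->
  graft v w s = Some t -> graft w v t = Some s.
Proof.
move=> vw; elim: s t => [|k s IH] t.
  by rewrite /=; case: eqP => // <- [<-]; exact: graft_stem.
have [->|sw] := eqVneq (k :: s) w.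
  by rewrite graft_stem => -[<-]; exact: graft_stem.
rewrite graftE (negPf sw); case: ifP => // /negbT kN.
case g: (graft v w s) => [t'|] //= [<-].
by rewrite (graft_cons _ (same_stem_sym vw) kN) (IH _ g).
Qed.

(** The induction on s carries a lower bound k outside the window.  When the
stem is reached, k lies below the first entry of w, hence below the window,
hence below the first entry of v. *)
Lemma graft_path v w k s t : same_stem v w -> sorted <%R v ->
  ~~ in_window k -> path <%R k s -> graft v w s = Some t -> path <%R k t.
Proof.
move=> vw sv; elim: s k t => [|j s IH] k t kN.
  by rewrite /=; case: eqP vw => // <- + _ [<-]; case: v {sv}.
have [->|sw] := eqVneq (j :: s) w.
  rewrite graft_stem => kw [<-]; case: w v vw sv kw {IH} => [|b w] [|a v] //=.
  move=> /andP[aN bN] -> /andP[kb _]; rewrite andbT.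
  by move: kN aN bN kb; rewrite /in_window; lia.
rewrite graftE (negPf sw) /= => /andP[kj js]; case: ifP => // /negbT jN.
by case g: (graft v w s) => [t'|] //= [<-] /=; rewrite kj (IH j t').
Qed.

Lemma graft_sorted v w s t : same_stem v w -> sorted <%R v ->
  sorted <%R s -> graft v w s = Some t -> sorted <%R t.
Proof.
move=> vw sv; have [->|sw] := eqVneq s w; first by rewrite graft_stem => _ [<-].
rewrite graftE (negPf sw); case: s sw => //= k s _ ks; case: ifP => // /negbT kN.
by case g: (graft v w s) => [t'|] //= [<-] /=; exact: graft_path g.
Qed.

Definition mgraft (v w r : mseq) : option mseq :=
  obind insub (graft (val v) (val w) (val r)).

Lemma mgraftE (v w r : mseq) : same_stem (val v) (val w) ->
  omap val (mgraft v w r) = graft (val v) (val w) (val r).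
Proof.
move=> vw; rewrite /mgraft; case g: (graft _ _ _) => [t|] //=.
have st := graft_sorted vw (valP v) (valP r) g.
by case: insubP => [u _ /= ->//|]; rewrite st.
Qed.

Lemma mgraft_transposed (v w : mseq) : same_stem (val v) (val w) ->
  transposed (mgraft v w) (mgraft w v).
Proof.
have half (v' w' r r' : mseq) : same_stem (val v') (val w') ->
    mgraft v' w' r = Some r' -> mgraft w' v' r' = Some r.
  move=> vw rr'; apply: (option_map_inj val_inj).
  rewrite (mgraftE _ (same_stem_sym vw)); apply: graft_sym => //.
  by rewrite -mgraftE// rr'.
by move=> vw r r'; split; apply: half => //; exact: same_stem_sym.
Qed.

(** A site outside the window is never the first entry of a stem, so deleting
it concerns only the part u of u ++ w that the graft leaves alone. *)
Lemma mgraft_behead (v w : mseq) i r : same_stem (val v) (val w) ->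
  ~~ in_window i ->
  obind (mgraft v w) (mseq_behead i r) = obind (mseq_behead i) (mgraft v w r).
Proof.
move=> vw iN.
pose bh s := if s is j :: t then if j == i then Some t else None else None.
have bhE u : omap val (mseq_behead i u) = bh (val u).
  case: u => -[|j u] ju //=; rewrite /mseq_behead /=; case: eqP => // _.
  by rewrite insubT //=; move/path_sorted: ju.
apply: (option_map_inj val_inj).
transitivity (obind (graft (val v) (val w)) (bh (val r))).
  by rewrite -bhE; case: (mseq_behead i r) => [u|] //=; rewrite mgraftE.
transitivity (obind bh (graft (val v) (val w) (val r))); last first.
  by rewrite -mgraftE//; case: (mgraft v w r) => [u|] //=; rewrite bhE.
have bh0 u u' : same_stem u u' -> bh u = None.
  case: u u' => [|j u] [|j' u'] //= /andP[jN _].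
  by case: eqP iN => // <-; rewrite jN.
have [rw|rw] := eqVneq (val r) (val w).
  by rewrite rw graft_stem /= (bh0 _ _ vw) (bh0 _ _ (same_stem_sym vw)).
rewrite graftE (negPf rw); case: (val r) => [|k s] //=.
case: (eqVneq k i) => [->|ki] /=.
  by rewrite (negPf iN); case: (graft _ _ s) => //= t; rewrite eqxx.
by case: ifP => // _; case: (graft _ _ s) => //= t; rewrite (negPf ki).
Qed.

End Graft.

(** * The tail algebra *)

Section TailAlgebra.
Context {R : realType}.
Implicit Types (T S : fock R -> fock R) (s t v w : mseq).

Definition grafts (N : nat) : set (fock R -> fock R) :=
  [set W | exists v w (vw : same_stem N (val v) (val w)),
     W = relabel (mgraft_transposed vw)].

Lemma bounded_grafts N : grafts N `<=` bounded_ops R mseq.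
Proof. by move=> _ [v [w [vw ->]]]; exact: bounded_relabel. Qed.

Lemma grafts_adjoint N V : grafts N V -> exists2 W, grafts N W & is_adjoint W V.
Proof.
move=> [v [w [vw ->]]]; have wv := same_stem_sym vw.
exists (relabel (mgraft_transposed wv)); first by exists w, v, wv.
have := relabel_adjoint (R := R) (mgraft_transposed wv).
congr is_adjoint; apply/funext => x; exact: ell2_inj.
Qed.

Lemma von_neumann_grafts N : von_neumann (commutant (grafts N)).
Proof.
by apply: von_neumann_commutant; [exact: bounded_grafts|exact: grafts_adjoint].
Qed.

Lemma creation_grafts N (k : int) : ~~ in_window N k ->
  commutant (grafts N) (@creation R k).
Proof.
move=> kN; split; first exact: bounded_creation.
move=> _ [v [w [vw ->]]]; apply/funext => x; apply/ell2_inj => s /=.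
rewrite !pullback_comp; congr (pullback _ x s); apply/funext => r.
exact: mgraft_behead.
Qed.

(** The grafts being stable under adjoints, this is the adjoint of
[creation_grafts]. *)
Lemma annihilation_grafts N (k : int) : ~~ in_window N k ->
  commutant (grafts N) (@annihilation R k).
Proof.
move=> kN; split; first exact: bounded_annihilation.
move=> W gW; have [V gV VW] := grafts_adjoint gW.
have [_ cV] := creation_grafts kN.
exact: (adjoint_commute (creation_adjoint k) VW (cV V gV)).
Qed.

Lemma site_map_grafts N (k : int) m : ~~ in_window N k ->
  commutant (grafts N) (@site_map R k m).
Proof.
move=> kN; have ca := annihilation_grafts kN; have cc := creation_grafts kN.
have cac := commutant_comp ca cc; have cca := commutant_comp cc ca.
have gb := @bounded_grafts N.
have cZ a T : commutant (grafts N) T -> commutant (grafts N) (a *: T).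
  exact: commutantZ.
rewrite /site_map; apply: (commutantD gb); last first.
  apply/cZ/(commutantB gb) => //; apply: (commutantB gb) => //.
  exact: commutant_id.
by do 3![apply: (commutantD gb); last exact: cZ]; exact: cZ.
Qed.

(** The window [-N, N] is one of the finite sets in the intersection that
defines the tail algebra. *)
Lemma tail_grafts N T W : tail_algebra R T -> grafts N W -> T \o W = W \o T.
Proof.
move=> tT gW; have bW := bounded_grafts gW.
pose A : set int := [set k | in_window N k].
have finA : finite_set A.
  apply: (@sub_finite_set _ _ ((fun n : nat => n%:Z) @` `I_N.+1 `|`
                               (fun n : nat => - n%:Z) @` `I_N.+1)).
    move=> k; rewrite /A /in_window /= => kN.
    have [k0|k0] := leP 0 k; [left|right]; exists `|k|%N => /=; lia.
  by rewrite finite_setU; split; exact/finite_image/finite_II.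
have [_ ->//] := tT A finA.
split=> // S [K [_ KA] vS].
have [_ -> //] : commutant (grafts N) S.
apply: vS; split; first exact: von_neumann_grafts.
move=> _ [k Kk [m _ <-]]; apply: site_map_grafts; apply/negP => kN.
by have : (K `&` A) k by []; rewrite KA.
Qed.

Definition radius (s : seq int) : nat := \sum_(i <- s) `|i|%N.

Lemma radiusP N (s : seq int) : (radius s <= N)%N -> all (in_window N) s.
Proof.
move=> sN; apply/allP => i si; rewrite /in_window.
have : (`|i|%N <= radius s)%N by rewrite /radius (big_rem _ si)/= leq_addr.
by move: sN; lia.
Qed.

Lemma tail_graftE N T v w (vw : same_stem N (val v) (val w)) x s :
  tail_algebra R T ->
  T (relabel (mgraft_transposed vw) x) s = pullback (mgraft N v w) (T x) s.
Proof.
move=> tT; have gW : grafts N (relabel (mgraft_transposed vw)) by exists v, w, vw.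
by have /(congr1 (@^~ x)) /= -> := tail_grafts tT gW.
Qed.

(** If the window contains all entries of s and t, then the graft of s onto
itself fixes e_s and kills e_t. *)
Lemma tail_diagonal T s t : tail_algebra R T -> t != s -> T (delta R s) t = 0.
Proof.
move=> tT ts; pose N := radius (val s ++ val t).
have : all (in_window N) (val s ++ val t) by exact: radiusP.
rewrite all_cat => /andP[sN tN].
have ss : same_stem N (val s) (val s).
  by case: (val s) sN => //= i v /andP[->].
have gs : mgraft N s s s = Some s.
  by apply: (option_map_inj val_inj); rewrite mgraftE// graft_stem.
have := tail_graftE ss (delta R s) t tT; rewrite (relabel_delta _ gs) => ->.
by rewrite /pullback /mgraft graft_self_None.
Qed.

(** If the window contains the first entries of v and w, then the graft sends
e_v to e_w. *)
Lemma tail_eigenvalue T v w : tail_algebra R T -> v != mseq0 -> w != mseq0 ->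
  T (delta R v) v = T (delta R w) w.
Proof.
move=> tT v0 w0; pose N := radius (val v ++ val w).
have : all (in_window N) (val v ++ val w) by exact: radiusP.
rewrite all_cat => /andP[vN wN].
have vw : same_stem N (val v) (val w).
  move: v0 w0 vN wN; rewrite -!val_eqE.
  by case: (val v) (val w) => [|i v'] [|j w'] //= _ _ /andP[-> _] /andP[->].
have gw : mgraft N v w w = Some v.
  by apply: (option_map_inj val_inj); rewrite mgraftE// graft_stem.
have := tail_graftE vw (delta R v) w tT.
by rewrite (relabel_delta _ gw) /pullback gw => ->.
Qed.

Lemma tail_algebraE : tail_algebra R = [set T | exists a b, T = vacuum_diag a b].
Proof.
apply/seteqP; split=> T.
  move=> tT; have [bT _] := tT set0 (finite_set0 _).
  (* Any nonempty sequence can serve to read off the second eigenvalue. *)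
  pose one : mseq := exist _ [:: 0%:Z] isT.
  exists (T (delta R mseq0) mseq0), (T (delta R one) one).
  apply: (bounded_op_ext bT (bounded_vacuum_diag _ _)) => s.
  have -> : T (delta R s) = T (delta R s) s *: delta R s.
    apply/ell2_inj => t; rewrite -[RHS]/(_ * (t == s)%:R).
    by case: eqVneq => [->|/(tail_diagonal tT)->]; rewrite ?mulr1 ?mulr0.
  rewrite /vacuum_diag !fctE /= vacuum_proj_delta.
  have [->|s0] := eqVneq s mseq0; first by rewrite subrr scaler0 addr0.
  by rewrite subr0 scaler0 add0r (tail_eigenvalue (w := one) tT s0).
move=> [a [b ->]] A finA; split; first exact: bounded_vacuum_diag.
move=> S [bS SA]; apply: vacuum_diag_commute => //.
apply: (vacuum_proj_commute finA) => // k Ak; apply: SA.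
(* The matrix unit at (0, 0) gives a_k a_k^+ as a value of iota_k. *)
exists [set k].
  split; first exact: finite_set1.
  by apply/seteqP; split=> // j /= [->].
move=> B [vB]; apply; exists k => //; exists (delta_mx 0 0, 0) => //.
by rewrite /site_map /= !mxE /= !scale0r scale1r !addr0.
Qed.

End TailAlgebra.

(** * The stationary algebra *)

Section Stationary.
Context {R : realType}.
Implicit Types (T S : fock R -> fock R).

Lemma shift_transposed :
  transposed (Some \o mseq_shift (- 1)) (Some \o mseq_shift 1).
Proof.
have K (a b : int) s : a + b = 0 -> mseq_shift a (mseq_shift b s) = s.
  move=> ab; apply/val_inj; rewrite /= -map_comp -[RHS]map_id.
  by apply: eq_map => i /=; lia.
by move=> s t; split=> -[<-] /=; rewrite K.
Qed.

Lemma shift_opE : @shift_op R = relabel shift_transposed.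
Proof. by apply/funext => x; exact: ell2_inj. Qed.

Lemma stationary_of_commute T : bounded_ops R mseq T ->
  T \o @shift_op R = @shift_op R \o T -> stationary_algebra R T.
Proof.
move=> bT TU; split=> //; rewrite -TU shift_opE (adjointE (relabel_adjoint _)).
apply/funext => x /=; congr (T _); apply/ell2_inj => s /=.
rewrite pullback_comp /pullback /=; congr (x _).
by have /shift_transposed [] := erefl (Some (mseq_shift (-1) s)).
Qed.

(** Equivariance under the inverse shift is what commuting with U means for
the partial map. *)
Lemma stationary_relabel g h (gh : transposed g h) :
  (forall s, g (mseq_shift (- 1) s) = omap (mseq_shift (- 1)) (g s)) ->
  stationary_algebra R (relabel gh).
Proof.
move=> gU; apply: stationary_of_commute; first exact: bounded_relabel.
apply/funext => x; apply/ell2_inj => s; rewrite shift_opE /= !pullback_comp.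
by rewrite /pullback /= gU; case: (g s).
Qed.

Lemma stationary_vacuum_diag a b : stationary_algebra R (vacuum_diag a b).
Proof.
apply: stationary_of_commute; first exact: bounded_vacuum_diag.
apply: vacuum_diag_commute; first by rewrite shift_opE; exact: bounded_relabel.
rewrite vacuum_projE shift_opE; apply/funext => x; apply/ell2_inj => s /=.
rewrite !pullback_comp; congr (pullback _ x s); apply/funext => t.
by case: t => -[|j t] jt.
Qed.

Definition is_particle (s : mseq) : bool := size (val s) == 1%N.

Definition single_pair (s : mseq) : option mseq :=
  if val s is [:: i] then insub [:: i; i + 1] else None.
Definition pair_single (s : mseq) : option mseq :=
  if val s is [:: i; j] then if j == i + 1 then insub [:: i] else None else None.

Lemma single_pair_transposed : transposed single_pair pair_single.
Proof.
move=> s t; rewrite /single_pair /pair_single; split.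
  case: s => -[|i [|j s]] js //=; case: insubP => //= u _ us [<-].
  by rewrite us eqxx; case: insubP => //= v _ vi; congr Some; apply/val_inj.
case: t => -[|i [|j [|k t]]] jt //=; case: eqP => // ji.
case: insubP => //= u _ us [<-]; rewrite us.
case: insubP => /= [v _ vi|]; last by rewrite ltrDl ltr01.
by congr Some; apply/val_inj; rewrite /= vi ji.
Qed.

Lemma stationary_single_pair : stationary_algebra R (relabel single_pair_transposed).
Proof.
apply: stationary_relabel => -[[|i [|j s]] js] //; rewrite /single_pair /=.
rewrite !insubT /= ?ltrDl ?ltr01// => ? ?; congr Some; apply/val_inj => /=.
by congr [:: _; _]; lia.
Qed.

Lemma stationary_particle :
  stationary_algebra R (relabel (id_on_transposed is_particle)).
Proof.
apply: stationary_relabel => s; rewrite /id_on.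
have -> k : is_particle (mseq_shift k s) = is_particle s.
  by rewrite /is_particle size_map.
by case: ifP.
Qed.

(** On e_(0,1), transferring to e_(0) and then projecting onto the one-particle
space gives e_(0), while the opposite order gives 0. *)
Lemma stationary_not_commutative :
  ~ (forall S T, stationary_algebra R S -> stationary_algebra R T ->
     S \o T = T \o S).
Proof.
move=> /(_ _ _ stationary_particle stationary_single_pair).
pose one : mseq := exist _ [:: 0%:Z] isT.
pose two : mseq := exist _ [:: 0%:Z; 1%:Z] isT.
have st : single_pair one = Some two.
  by apply: (option_map_inj val_inj); rewrite /single_pair /= insubT.
move=> /(congr1 (@^~ (delta R two))); rewrite /comp (relabel_delta _ st).
rewrite (@relabel_delta0 _ _ _ _ _ two)// (bounded_op0 (bounded_relabel _)).
rewrite (@relabel_delta _ _ _ _ _ one one)//.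
by move=> /(congr1 (fun x : fock R => x one)) /= /eqP; rewrite oner_eq0.
Qed.

End Stationary.

Theorem mainTheorem5 (R : realType) :
  [/\ tail_algebra R =
        [set T : fock R -> fock R | exists a b : R[i],
           T = a *: @vacuum_proj R + b *: (idfun - @vacuum_proj R)],
      tail_algebra R `<` stationary_algebra R
    & ~ (forall S T : fock R -> fock R,
           stationary_algebra R S -> stationary_algebra R T ->
           S \o T = T \o S)].
Proof.
split; [exact: tail_algebraE| |exact: stationary_not_commutative].
rewrite tail_algebraE; split=> [_ [a [b ->]]|stat].
  exact: stationary_vacuum_diag.
apply: (@stationary_not_commutative R) => S T /stat [a [b ->]] /stat [c [d ->]].
apply: vacuum_diag_commute; first exact: bounded_vacuum_diag.
by apply/esym/vacuum_diag_commute => //; exact: bounded_vacuum_proj.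
Qed.
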